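(* Let $A\in\mathbb C^{6\times 6}$ be a reciprocal matrix with superdiagonal entries $b_j$ and subdiagonal entries $c_j=b_j^{-1}$, and let $A_j=\frac12(|b_j|^2+|c_j|^2)$ for $j=1,\dots,5$. Then the Kippenhahn curve $C(A)$ has an elliptical component if and only if there is a root $x$ of the cubic equation $$8x^3-20x^2+12x-1=0$$ such that $R_1(x)=R_2(x)=0$, where $R_1$ and $R_2$ are the resultants (with respect to $z$) of the pairs $Q_1,Q_2$ and $Q_1,Q_3$, respectively, of the polynomials $Q_1,Q_2,Q_3$ defined in the context.
   Context: A reciprocal matrix is a tridiagonal matrix $A\in\mathbb C^{n\times n}$ with zero main diagonal, superdiagonal entries $b_1,\dots,b_{n-1}$ and subdiagonal entries $c_1,\dots,c_{n-1}$ satisfying $b_jc_j=1$ for all $j$. Kippenhahn curve: write $\operatorname{Re}M=(M+M^* )/2$ and $P_A(\lambda,\theta)=\det(\operatorname{Re}(e^{i\theta}A)-\lambda I)$ (the NR generating polynomial). $C(A)$ is the class-$n$ algebraic curve in $\mathbb C\cong\mathbb R^2$ whose tangent lines are $\{e^{-i\theta}(\lambda_k(\theta)+it):t\in\mathbb R\}$, $k=1,\dots,n$, $\theta\in\mathbb R$, where $\lambda_1(\theta),\dots,\lambda_n(\theta)$ are the eigenvalues of $\operatorname{Re}(e^{i\theta}A)$. Components of $C(A)$ (with multiplicity) correspond to factors of $P_A$: an ellipse centered at $w_0\in\mathbb C$ is a component when $P_A$ is divisible by $(\lambda-\operatorname{Re}(e^{i\theta}w_0))^2-(x\cos 2\theta+y\sin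 2\theta+z)$ for the corresponding $x,y,z\in\mathbb R$ with $z\ge\sqrt{x^2+y^2}$, $z>0$; when $z=\sqrt{x^2+y^2}$ the ellipse is degenerate, namely the doubleton of its foci. An elliptical component of $C(A)$ is allowed to be degenerate in this sense. For $n=6$ put $S=A_1+A_2+A_3+A_4+A_5$, $L=3A_1+2A_2+2A_3+2A_4+3A_5$, $T=A_1+A_3+A_5$, $M=A_1A_3+A_1A_4+A_1A_5+A_2A_4+A_2A_5+A_3A_5$, $N=A_1A_3+A_1A_5+A_3A_5$. Define polynomials in $z$ with coefficients depending on $x$: $$Q_1=q_{11}z+q_{10},\quad Q_2=q_{22}z^2+q_{21}z+q_{20},\quad Q_3=z^3+q_{32}z^2+q_{31}z+q_{30},$$ where $q_{11}=3x^2-5x+\frac32$, $q_{10}=-\frac12Sx^2+\frac14Lx-\frac18T$, $q_{22}=3x-\frac52$, $q_{21}=-Sx+\frac14L$, $q_{20}=\frac14Mx-\frac18N$, $q_{32}=-\frac12S$, $q_{31}=\frac14M$, $q_{30}=-\frac18A_1A_3A_5$. The resultants are, up to sign, $$R_1=q_{22}q_{10}^2-q_{21}q_{10}q_{11}+q_{20}q_{11}^2,\qquad R_2=-q_{10}^3+q_{32}q_{10}^2q_{11}-q_{31}q_{10}q_{11}^2+q_{30}q_{11}^3.$$ *)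

(* Defs.v *)
From HB Require Import structures.
From mathcomp Require Import all_boot all_order all_algebra.
From mathcomp Require Import complex ring.
From mathcomp Require Import reals trigo.

Set Implicit Arguments.
Unset Strict Implicit.
Unset Printing Implicit Defensive.

Import Order.TTheory GRing.Theory Num.Theory.
Local Open Scope ring_scope.
Local Open Scope complex_scope.

Section Reciprocal.
Variable R : realType.

(* b_{j+1} and c_{j+1} for j : 'I_n; the matrix has size n.+1. *)
Definition superdiag n (A : 'M[R[i]]_n.+1) (j : 'I_n) : R[i] :=
  A (widen_ord (leqnSn n) j) (lift ord0 j).

Definition subdiag n (A : 'M[R[i]]_n.+1) (j : 'I_n) : R[i] :=
  A (lift ord0 j) (widen_ord (leqnSn n) j).

(* The first clause covers the main diagonal as well. *)
Definition reciprocal n (A : 'M[R[i]]_n.+1) : Prop :=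
  (forall i j : 'I_n.+1, i.+1 != j -> j.+1 != i -> A i j = 0) /\
  (forall j : 'I_n, superdiag A j * subdiag A j = 1).

(* A_{j+1} = (|b_{j+1}|^2 + |c_{j+1}|^2) / 2 *)
Definition mean_sqr n (A : 'M[R[i]]_n.+1) (j : 'I_n) : R :=
  (Normc.normc (superdiag A j) ^+ 2
   + Normc.normc (subdiag A j) ^+ 2) / 2.

End Reciprocal.

Section Kippenhahn.
Variable R : realType.

Definition cis (t : R) : R[i] := cos t +i* sin t.

Definition hermitian_part n (M : 'M[R[i]]_n) : 'M[R[i]]_n :=
  2^-1 *: (M + map_mx (@conjc R) M^T).

(* P_A(lambda, theta), as a polynomial in lambda *)
Definition NRpoly n (A : 'M[R[i]]_n) (theta : R) : {poly R[i]} :=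
  \det (map_mx polyC (hermitian_part (cis theta *: A)) - 'X%:M).

Definition ellipse_poly (w0 : R[i]) (x y z theta : R) : {poly R[i]} :=
  ('X - ((complex.Re (cis theta * w0))%:C)%:P) ^+ 2
  - ((x * cos (2 * theta) + y * sin (2 * theta) + z)%:C)%:P.

(* Divisibility is stated for each theta separately: as the divisor is monic  *)
(* in lambda, the quotients then have coefficients that are trigonometric     *)
(* polynomials in theta, so this is divisibility of P_A as a polynomial in    *)
(* lambda over the trigonometric polynomials.  Degenerate ellipses,           *)
(* z = sqrt (x^2 + y^2), are allowed.                                         *)
Definition has_elliptical_component n (A : 'M[R[i]]_n) : Prop :=
  exists (w0 : R[i]) (x y z : R),
    [/\ Num.sqrt (x ^+ 2 + y ^+ 2) <= z, 0 < z
      & forall theta : R, ellipse_poly w0 x y z theta %| NRpoly A theta].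

End Kippenhahn.

(* A_k is a (inord (k - 1)).  In Q1, Q2, Q3 : {poly {poly R}} the outer       *)
(* variable is z and the inner one is x, so that R1 and R2 are polynomials in *)
(* x; q11 and q22 do not vanish at the roots of 8x^3 - 20x^2 + 12x - 1, hence *)
(* evaluating R1 and R2 there is the same as eliminating z at fixed x.        *)
Section Resultants.
Variables (R : realType) (a : 'I_5 -> R).

Let A1 := a (inord 0).
Let A2 := a (inord 1).
Let A3 := a (inord 2).
Let A4 := a (inord 3).
Let A5 := a (inord 4).

Definition coefS : R := A1 + A2 + A3 + A4 + A5.
Definition coefL : R := 3 * A1 + 2 * A2 + 2 * A3 + 2 * A4 + 3 * A5.
Definition coefT : R := A1 + A3 + A5.
Definition coefM : R :=
  A1 * A3 + A1 * A4 + A1 * A5 + A2 * A4 + A2 * A5 + A3 * A5.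
Definition coefN : R := A1 * A3 + A1 * A5 + A3 * A5.

Definition q11 : {poly R} := 3 *: 'X^2 - 5 *: 'X + (3 / 2)%:P.
Definition q10 : {poly R} :=
  - (coefS / 2) *: 'X^2 + (coefL / 4) *: 'X - (coefT / 8)%:P.
Definition q22 : {poly R} := 3 *: 'X - (5 / 2)%:P.
Definition q21 : {poly R} := - coefS *: 'X + (coefL / 4)%:P.
Definition q20 : {poly R} := (coefM / 4) *: 'X - (coefN / 8)%:P.
Definition q32 : {poly R} := (- (coefS / 2))%:P.
Definition q31 : {poly R} := (coefM / 4)%:P.
Definition q30 : {poly R} := (- (A1 * A3 * A5 / 8))%:P.

Definition Q1 : {poly {poly R}} := q11 *: 'X + q10%:P.
Definition Q2 : {poly {poly R}} := q22 *: 'X^2 + q21 *: 'X + q20%:P.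
Definition Q3 : {poly {poly R}} := 'X^3 + q32 *: 'X^2 + q31 *: 'X + q30%:P.

Definition R1 : {poly R} := resultant Q1 Q2.
Definition R2 : {poly R} := resultant Q1 Q3.

Lemma q11_neq0 : q11 != 0.
Proof.
apply/eqP => /(congr1 (fun p : {poly R} => p`_2)).
by rewrite !coefE /= !(mulr0, mulr1, subr0, addr0) => /eqP; rewrite pnatr_eq0.
Qed.

Lemma q22_neq0 : q22 != 0.
Proof.
apply/eqP => /(congr1 (fun p : {poly R} => p`_1)).
by rewrite !coefE /= !(mulr0, mulr1, subr0, addr0) => /eqP; rewrite pnatr_eq0.
Qed.

Lemma size_Q1 : size Q1 = 2.
Proof.
by rewrite /Q1 -mul_polyC size_MXaddC polyC_eq0 (negPf q11_neq0) size_polyC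
           q11_neq0.
Qed.

Lemma size_Q2 : size Q2 = 3.
Proof.
rewrite /Q2 -addrA size_polyDl size_scale ?q22_neq0 ?size_polyXn // ltnS.
by apply/leq_sizeP => -[|[|j]] // _; rewrite !coefE /= mulr0 addr0.
Qed.

Lemma size_Q3 : size Q3 = 4.
Proof.
rewrite /Q3 -!addrA size_polyDl size_polyXn // ltnS.
by apply/leq_sizeP => -[|[|[|j]]] // _; rewrite !coefE /= !mulr0 !addr0.
Qed.

Lemma resultant_dim (p q : {poly {poly R}}) m n :
    (size q).-1 = m -> (size p).-1 = n ->
  resultant p q = \det (\matrix_(i < m + n, j < m + n)
    if (i < m)%N then p`_(j - i) *+ (i <= j)%N
    else q`_(j - (i - m)) *+ (i - m <= j)%N).
Proof.
move=> <- <-; congr (\det _); apply/matrixP => i j.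
by rewrite Sylvester_mxE mxE; case: splitP => k ->; rewrite ?addKn.
Qed.

Lemma R1E : R1 = q22 * q10 ^+ 2 - q21 * q10 * q11 + q20 * q11 ^+ 2.
Proof.
rewrite /R1 (@resultant_dim _ _ 2 1) ?size_Q1 ?size_Q2 // addn1.
have [c0 c1 c2] : [/\ Q1`_0 = q10, Q1`_1 = q11 & Q1`_2 = 0].
  by rewrite /Q1 !coefE /= !(mulr0, mulr1, addr0, add0r).
have [d0 d1 d2] : [/\ Q2`_0 = q20, Q2`_1 = q21 & Q2`_2 = q22].
  by rewrite /Q2 !coefE /= !(mulr0, mulr1, addr0, add0r).
do 3!rewrite ?(expand_det_row _ ord0) ?big_ord_recl ?big_ord0 /cofactor ?mxE /=
             ?c0 ?c1 ?c2 ?(mulr0n, mulr1n, mul0r, addr0, add0r).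
rewrite !det_mx00 /bump /= ?c0 ?c1 ?c2 ?d0 ?d1 ?d2; ring.
Qed.

Lemma R2E :
  R2 = - (- q10 ^+ 3 + q32 * q10 ^+ 2 * q11 - q31 * q10 * q11 ^+ 2
          + q30 * q11 ^+ 3).
Proof.
rewrite /R2 (@resultant_dim _ _ 3 1) ?size_Q1 ?size_Q3 // addn1.
have [c0 c1 c2 c3] : [/\ Q1`_0 = q10, Q1`_1 = q11, Q1`_2 = 0 & Q1`_3 = 0].
  by rewrite /Q1 !coefE /= !(mulr0, mulr1, addr0, add0r).
have [d0 d1 d2 d3] : [/\ Q3`_0 = q30, Q3`_1 = q31, Q3`_2 = q32 & Q3`_3 = 1].
  by rewrite /Q3 !coefE /= !(mulr0, mulr1, addr0, add0r).
do 4!rewrite ?(expand_det_row _ ord0) ?big_ord_recl ?big_ord0 /cofactor ?mxE /=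
             ?c0 ?c1 ?c2 ?c3 ?(mulr0n, mulr1n, mul0r, addr0, add0r).
rewrite !det_mx00 /bump /= ?c0 ?c1 ?c2 ?c3 ?d0 ?d1 ?d2 ?d3; ring.
Qed.

End Resultants.

(* Main.v *)
Require Import Defs.
From mathcomp Require Import all_boot all_order all_algebra.
From mathcomp Require Import complex.
From mathcomp Require Import reals.
From mathcomp Require Import trigo ring lra.

Import Order.TTheory GRing.Theory Num.Theory.
Local Open Scope ring_scope.
Local Open Scope complex_scope.

(** Expanding the tridiagonal determinant, b_j c_j = 1 turns the product of
    opposite off-diagonal entries of Re(e^(i theta) A) into
    u_j = (A_j + tau) / 2 with tau = cos (2 theta).  Hence P_A is p(lambda^2),
    where p is a monic cubic whose coefficients are polynomials in tau
    ([nr_cubic], [NRpoly_nr_cubic]).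

    An ellipse centered at the origin with axes along the coordinate axes, that
    is with w0 = 0 and y = 0, is a component exactly when x tau + z is a root
    of p for all tau.  Expanding p(x tau + z) in powers of tau gives four
    coefficients: an eighth of the cubic of the theorem, Q1(z), Q2(z) and Q3(z)
    ([nr_cubic_line_root]).  At a root x of that cubic q11 does not vanish, as
    q11 is proportional to its derivative and its roots are simple; therefore
    z = - q10 / q11, and Q2(z), Q3(z) vanish exactly when R1(x), R2(x) do.
    Conversely such a root x tau + z gives a genuine ellipse: because A_j >= 1,
    p has no negative root when tau >= -1, and tau = 1, -1 give |x| <= z.

    It remains to see that any elliptical component yields a root of p which is
    affine in tau.  If w0 <> 0, the component and its mirror image
    under lambda |-> - lambda use up two of the three roots of p, and the third
    root, known from the sum of the roots, is again a trigonometric polynomial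
    x cos (2 theta) + y sin (2 theta) + z ([dvdp_cubic_offcenter],
    [ellipse_harmonic_root]).  If then y <> 0, p depends on theta only through
    cos (2 theta), so theta and - theta give two distinct roots, and the third
    one is of the form x tau + z ([harmonic_root_line]).  These arguments
    break down at finitely many tau, which does not matter for an identity
    between polynomials in tau ([line_root_extend]). *)

(** * Determinants of tridiagonal matrices *)

(** Both off-diagonals are indexed from 0 by the smaller of the row and the
    column, so that u k and v k are opposite entries. *)
Definition tridiag {K : pzRingType} n (d u v : nat -> K) : 'M[K]_n :=
  \matrix_(i < n, j < n)
    if i == j :> nat then d i
    else if j == i.+1 :> nat then u i
    else if i == j.+1 :> nat then v j else 0.

Lemma det_tridiag_rec (K : comPzRingType) n (d u v : nat -> K) :
  \det (tridiag n.+2 d u v) =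
    d 0%N * \det (tridiag n.+1 (d \o succn) (u \o succn) (v \o succn))
    - u 0%N * v 0%N * \det (tridiag n (fun k => d k.+2) (fun k => u k.+2)
                                  (fun k => v k.+2)).
Proof.
have liftS m (i : 'I_m) : lift ord0 i = i.+1 :> nat by rewrite /= /bump leq0n.
rewrite (expand_det_row _ ord0) 2!big_ord_recl big1 ?addr0; last first.
  by move=> j _; rewrite !mxE !liftS mul0r.
rewrite /cofactor !mxE /= !addn0 expr0 expr1 mul1r mulN1r mulrN.
congr (d 0%N * \det _ - _).
  by apply/matrixP=> i j; rewrite !mxE /= /bump !leq0n !add1n !eqSS.
rewrite -!mulrA; congr (_ * _).
rewrite (expand_det_col _ ord0) big_ord_recl big1 ?addr0; last first.
  by move=> j _; rewrite !mxE /= /bump /= mul0r.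
rewrite /cofactor !mxE /= addn0 expr0 mul1r; congr (v 0%N * \det _).
by apply/matrixP=> i j; rewrite !mxE /= /bump !leq0n /= !add1n !eqSS.
Qed.

(** This is the matching polynomial of the path: with a constant diagonal d,
    each set of pairwise non-adjacent edges contributes the product of its
    - w k, times d to the number of vertices left over. *)
Lemma det_tridiag6 (K : comPzRingType) (d : K) (u v w : nat -> K) :
    (forall k, (k < 5)%N -> u k * v k = w k) ->
  \det (tridiag 6 (fun=> d) u v) =
    d ^+ 6 - (w 0%N + w 1%N + w 2%N + w 3%N + w 4%N) * d ^+ 4
    + (w 0%N * w 2%N + w 0%N * w 3%N + w 0%N * w 4%N + w 1%N * w 3%N
       + w 1%N * w 4%N + w 2%N * w 4%N)
      * d ^+ 2
    - w 0%N * w 2%N * w 4%N.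
Proof.
move=> uv.
have det1 d' u' v' : \det (tridiag 1 d' u' v') = d' 0%N :> K.
  by rewrite det_mx11 mxE.
rewrite !det_tridiag_rec /= !det1 !det_mx00 -!uv //=; ring.
Qed.

(** * Quadratic factors of an even sextic *)

(** Modulo 'X^2 - s, the polynomial p('X^2) is the constant p(s). *)
Lemma dvdp_comp_sqr (K : fieldType) (p : {poly K}) (s : K) :
  ('X^2 - s%:P %| p \Po 'X^2) = root p s.
Proof.
have Ds : ('X - s%:P) \Po 'X^2 = 'X^2 - s%:P :> {poly K}.
  by rewrite comp_polyB comp_polyX comp_polyC.
have sub_dvd : 'X^2 - s%:P %| (p - p.[s]%:P) \Po 'X^2.
  rewrite -Ds dvdp_comp_poly // dvdp_XsubCl /root !hornerE subrr //.
have -> : p \Po 'X^2 = (p - p.[s]%:P) \Po 'X^2 + p.[s]%:P.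
  by rewrite comp_polyB comp_polyC subrK.
rewrite dvdp_addr // /root; apply/idP/eqP=> [/dvdp_leq|->]; last exact: dvdp0.
rewrite polyC_eq0 size_XnsubC // size_polyC => dv; apply/eqP; apply: contraT.
by move=> /[dup] /dv; case: (_ != 0).
Qed.

Definition cubic {K : nzRingType} (e1 e2 e3 : K) : {poly K} :=
  'X^3 - e1 *: 'X^2 + e2 *: 'X - e3%:P.

Lemma horner_cubic (K : comNzRingType) (e1 e2 e3 t : K) :
  (cubic e1 e2 e3).[t] = t ^+ 3 - e1 * t ^+ 2 + e2 * t - e3.
Proof. by rewrite /cubic !hornerE. Qed.

(** The roots of the cubic sum to e1. *)
Lemma root_cubic_third (K : idomainType) (e1 e2 e3 s t : K) : s != t ->
    root (cubic e1 e2 e3) s -> root (cubic e1 e2 e3) t ->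
  root (cubic e1 e2 e3) (e1 - s - t).
Proof.
rewrite /root !horner_cubic -subr_eq0 => st /eqP ps /eqP pt.
rewrite -(mulrI_eq0 _ (mulfI st)); apply/eqP.
set r := e1 - s - t.
set c := (X in X = 0) in ps; set c' := (X in X = 0) in pt.
transitivity ((r - t) * c - (r - s) * c'); last by rewrite ps pt !mulr0 subr0.
rewrite /c /c' /r; ring.
Qed.

(** The quadratic E = ('X - l)^2 - s and its mirror image in - 'X have product
    D('X^2), where D = 'X^2 - 2 (l^2 + s) 'X + (l^2 - s)^2.  If E divides
    p('X^2), then E divides the remainder of p by D, evaluated at 'X^2.  Modulo
    E, 'X^2 is 2 l 'X - (l^2 - s), which is not constant as 2 l <> 0; so this
    remainder vanishes, D divides p, and the cofactor of D gives the third
    root. *)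
Lemma dvdp_cubic_offcenter (K : fieldType) (e1 e2 e3 l s : K) :
    l + l != 0 ->
    ('X - l%:P) ^+ 2 - s%:P %| cubic e1 e2 e3 \Po 'X^2 ->
  root (cubic e1 e2 e3) (e1 - 2 * (l ^+ 2 + s)).
Proof.
move=> l0; set E := _ - _ => dvdE.
set t := e1 - _; set m := l ^+ 2 - s; set k := 2 * (l ^+ 2 + s).
set r1 := e2 - m ^+ 2 - t * k; set r0 := t * m ^+ 2 - e3.
(* F is the mirror image of E, and r1 'X + r0 is the remainder of p by D. *)
pose F := 'X^2 + (l + l) *: 'X + m%:P : {poly K}.
have DP : cubic e1 e2 e3 \Po 'X^2 =
    E * (F * ('X^2 - t%:P) + r1%:P) + (((l + l) * r1) *: 'X + (r0 - m * r1)%:P).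
  rewrite /cubic !(comp_polyB, comp_polyD, comp_polyZ, comp_polyC, comp_polyX).
  rewrite ?comp_Xn_poly /E /F /r0 /r1 /t /m /k.
  by rewrite -!mul_polyC !(polyCD, polyCN, polyCM, rmorphXn) /= polyC1; ring.
have sE : size E = 3.
  rewrite /E size_polyDl; first by rewrite size_exp_XsubC.
  by rewrite size_exp_XsubC size_polyN size_polyC; case: (_ != 0).
have /polyP rem0 : (l + l) * r1 *: 'X + (r0 - m * r1)%:P = 0 :> {poly K}.
  apply/eqP; apply: contraTT dvdE => rem0; rewrite DP dvdp_addr ?dvdp_mulr //.
  apply/negP=> /(dvdp_leq rem0); rewrite sE leqNgt -mul_polyC.
  by rewrite size_MXaddC; case: ifP => // _; rewrite !ltnS size_polyC leq_b1.
have r1_0 : r1 = 0.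
  have := rem0 1; rewrite !coefE /= mulr1 addr0 => /eqP.
  by rewrite mulf_eq0 (negPf l0) => /eqP.
have r0_0 : r0 = 0 by have := rem0 0; rewrite !coefE /= r1_0 !mulr0 add0r subr0.
rewrite /root horner_cubic; apply/eqP.
have -> : t ^+ 3 - e1 * t ^+ 2 + e2 * t - e3 = r1 * t + r0.
  rewrite /r1 /r0 /t /m /k; ring.
by rewrite r1_0 r0_0 mul0r addr0.
Qed.

(** At a negative t all four terms are nonpositive, the first one strictly. *)
Lemma cubic_root_ge0 (F : realDomainType) (e1 e2 e3 t : F) :
    0 <= e1 -> 0 <= e2 -> 0 <= e3 -> root (cubic e1 e2 e3) t -> 0 <= t.
Proof.
move=> e1_ge0 e2_ge0 e3_ge0; rewrite /root horner_cubic leNgt => /eqP pt.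
apply/negP=> t_lt0; have t3 : t ^+ 3 < 0 by rewrite exprn_odd_lt0.
have t2 : 0 <= e1 * t ^+ 2 by rewrite mulr_ge0 ?sqr_ge0.
have t1 : e2 * t <= 0 by rewrite mulr_ge0_le0 // ltW.
lra.
Qed.

(** The numbers 1/2, 1/3, 1/4, etc. are infinitely many roots. *)
Lemma poly_eq0_on_itv (F : realFieldType) (p : {poly F}) :
  (forall t, -1 < t < 1 -> p.[t] = 0) -> p = 0.
Proof.
move=> p0; apply/eqP; apply: contraT => pn0.
pose f k : F := k.+2%:R^-1.
have f_inj : injective f.
  by move=> i j /invr_inj /eqP; rewrite eqr_nat => /eqP[].
suff /(max_poly_roots pn0) : all (root p) (mkseq f (size p)).
  by rewrite size_mkseq ltnn mkseq_uniq // => ->.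
apply/allP=> _ /mapP[k _ ->]; apply/eqP/p0; rewrite /f.
rewrite invf_lt1 ?ltr0n // ltr1n andbT.
by rewrite (lt_trans (ltrN10 F)) // invr_gt0 ltr0n.
Qed.

(** * The cubic satisfied by the squared eigenvalues *)

(** The cubic p with P_A(lambda, theta) = p(lambda^2), where
    tau = cos (2 theta) and a lists the A_j. *)
Definition nr_cubic {F : fieldType} (a : 'I_5 -> F) (tau : F) : {poly F} :=
  let u k := (a (inord k) + tau) / 2 in
  cubic (u 0%N + u 1%N + u 2%N + u 3%N + u 4%N)
    (u 0%N * u 2%N + u 0%N * u 3%N + u 0%N * u 4%N + u 1%N * u 3%N
     + u 1%N * u 4%N + u 2%N * u 4%N)
    (u 0%N * u 2%N * u 4%N).

(** The definitions of Q1, Q2 and Q3 are explained by this expansion in powers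
    of tau. *)
Lemma horner_nr_cubic_line (R : realType) (a : 'I_5 -> R) (x z tau : R) :
  (nr_cubic a tau).[x * tau + z] =
    (8 * x ^+ 3 - 20 * x ^+ 2 + 12 * x - 1) / 8 * tau ^+ 3
    + ((q11 R).[x] * z + (q10 a).[x]) * tau ^+ 2
    + ((q22 R).[x] * z ^+ 2 + (q21 a).[x] * z + (q20 a).[x]) * tau
    + (z ^+ 3 + (q32 a).[x] * z ^+ 2 + (q31 a).[x] * z + (q30 a).[x]).
Proof.
rewrite horner_cubic /q11 /q10 /q22 /q21 /q20 /q32 /q31 /q30.
rewrite !(hornerD, hornerN, hornerZ, hornerXn, hornerX, hornerC).
rewrite /coefS /coefL /coefT /Defs.coefM /Defs.coefN; by field.
Qed.

Lemma nr_cubic_line_root (R : realType) (a : 'I_5 -> R) (x z : R) :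
    (forall tau, root (nr_cubic a tau) (x * tau + z)) <->
  [/\ 8 * x ^+ 3 - 20 * x ^+ 2 + 12 * x - 1 = 0,
      (q11 R).[x] * z + (q10 a).[x] = 0,
      (q22 R).[x] * z ^+ 2 + (q21 a).[x] * z + (q20 a).[x] = 0
    & z ^+ 3 + (q32 a).[x] * z ^+ 2 + (q31 a).[x] * z + (q30 a).[x] = 0].
Proof.
split=> [line | [c3 c2 c1 c0] tau]; last first.
  by rewrite /root horner_nr_cubic_line c3 c2 c1 c0 !mul0r !addr0.
have lineE tau := eqP (line tau).
(* Four values of tau determine the four coefficients. *)
have := (lineE 0, lineE 1, lineE (-1), lineE 2).
rewrite !horner_nr_cubic_line.
set c3 := _ - 1; set c2 := _ + (q10 a).[x]; set c1 := _ + (q20 a).[x].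
set c0 := _ + (q30 a).[x].
by case=> [[[H1 H2] H3] H4]; split; lra.
Qed.

(** The polynomial q11 is an eighth of the derivative of this cubic f.  With
    g = 2 q11, one has 9 f - (12 x - 10) g = 7 (3 - 4 x), so a common root
    could only be 3/4, which is not a root of q11. *)
Lemma q11_root_neq0 (R : realType) (x : R) :
  8 * x ^+ 3 - 20 * x ^+ 2 + 12 * x - 1 = 0 -> (q11 R).[x] != 0.
Proof.
rewrite /q11 !(hornerD, hornerN, hornerZ, hornerXn, hornerX, hornerC) => x0.
apply/negP=> /eqP q0.
have xq0 : x * (3 * x ^+ 2 - 5 * x + 3 / 2) = 0 by rewrite q0 mulr0.
have x34 : x = 3 / 4 by lra.
by move: q0; rewrite x34; lra.
Qed.

(** * The NR generating polynomial of a reciprocal matrix *)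

Lemma hermitian_part_entry {R : realType} n (A : 'M[R[i]]_n) (theta : R) i j :
  hermitian_part (cis theta *: A) i j =
    2^-1 * (cis theta * A i j + conjc (cis theta * A j i)).
Proof. by rewrite !mxE. Qed.

(** Since Re(b c) = 1, 2 (A_j - 1) = |b|^2 + |c|^2 - 2 Re(b c) is the squared
    modulus of b - conj(c). *)
Lemma mean_sqr_ge1 (R : realType) n (A : 'M[R[i]]_n.+1) (j : 'I_n) :
  reciprocal A -> 1 <= mean_sqr A j.
Proof.
case=> _ /(_ j); rewrite /mean_sqr.
case: (superdiag A j) (subdiag A j) => [b1 b2] [c1 c2] /=.
move=> /eqP; rewrite eq_complex /= => /andP[/eqP bc1 _].
rewrite !sqr_sqrtr ?addr_ge0 ?sqr_ge0 //.
have := sqr_ge0 (b1 - c1); have := sqr_ge0 (b2 + c2); lra.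
Qed.

(** The two entries are conjugate, and the product is a quarter of the squared
    modulus of e^(i theta) b + e^(- i theta) conj(c), whose cross term is
    2 Re(e^(2 i theta) b c) = 2 cos (2 theta). *)
Lemma hermitian_offdiag_prod (R : realType) n (A : 'M[R[i]]_n.+1)
    (theta : R) (j : 'I_n) :
    reciprocal A ->
  let H := hermitian_part (cis theta *: A) in
  superdiag H j * subdiag H j = ((mean_sqr A j + cos (2 * theta)) / 2)%:C.
Proof.
case=> _ /(_ j) bc /=.
rewrite /superdiag /subdiag !hermitian_part_entry.
rewrite -/(superdiag A j) -/(subdiag A j) /mean_sqr; move: bc.
case: (superdiag A j) (subdiag A j) => [b1 b2] [c1 c2] /=.
move=> /eqP; rewrite eq_complex /= => /andP[/eqP bc1 /eqP bc2].
rewrite !sqr_sqrtr ?addr_ge0 ?sqr_ge0 //.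
have -> : (2^-1 : R[i]) = (2^-1)%:C by rewrite fmorphV rmorph_nat.
have c2E : cos (2 * theta) = cos theta ^+ 2 - sin theta ^+ 2.
  by rewrite mulr_natl cos_mulr2n; have := cos2Dsin2 theta; lra.
rewrite c2E /cis; move: (cos2Dsin2 theta).
move: (cos theta) (sin theta) => c s cs.
apply/eqP; rewrite eq_complex /=; apply/andP; split; apply/eqP; last by ring.
transitivity ((c ^+ 2 + s ^+ 2) * (b1 ^+ 2 + b2 ^+ 2 + (c1 ^+ 2 + c2 ^+ 2)) / 4
  + (c ^+ 2 - s ^+ 2) * (b1 * c1 - b2 * c2) / 2 - c * s * (b1 * c2 + b2 * c1)).
  by field.
by rewrite cs bc1 bc2; field.
Qed.

Lemma NRpoly_nr_cubic (R : realType) (A : 'M[R[i]]_6) (theta : R) :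
    reciprocal A ->
  NRpoly A theta =
    map_poly (real_complex R)
      (nr_cubic (mean_sqr A) (cos (2 * theta)) \Po 'X^2).
Proof.
move=> hA; set tau := cos _; rewrite /NRpoly.
have := fun j => hermitian_offdiag_prod _ _ _ theta j hA.
have: forall i j : 'I_6, i.+1 != j -> j.+1 != i ->
    hermitian_part (cis theta *: A) i j = 0.
  move=> i j ij ji; rewrite hermitian_part_entry !hA.1 //.
  by rewrite !mulr0 conjc0 addr0 mulr0.
move: (hermitian_part _) => H H0 Hprod.
pose u k := (H (inord k) (inord k.+1))%:P.
pose v k := (H (inord k.+1) (inord k))%:P.
pose w k := ((mean_sqr A (inord k) + tau) / 2)%:C%:P.
have uv k : (k < 5)%N -> u k * v k = w k.
  move=> k5; rewrite /u /v /w -polyCM -Hprod.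
  by congr (_ * _)%:P; congr (H _ _); apply: val_inj;
     rewrite /= ?inordK ?lift0 //= ?inordK // ltnW.
have -> : map_mx polyC H - 'X%:M = tridiag 6 (fun=> - 'X) u v.
  apply/matrixP=> i j; rewrite !mxE.
  have [ij | ij] := eqVneq (i : nat) j.
    rewrite H0 ?ij ?neq_ltn ?ltnSn ?orbT // (val_inj ij : i = j).
    by rewrite eqxx mulr1n sub0r.
  have -> : (i == j) = false by apply/negP=> /eqP E; rewrite E eqxx in ij.
  rewrite mulr0n subr0.
  have [ji | ji] := eqVneq (j : nat) i.+1.
    by rewrite /u -ji !inord_val.
  have [{}ij | {}ij] := eqVneq (i : nat) j.+1.
    by rewrite /v -ij !inord_val.
  by rewrite H0 // eq_sym.
rewrite (det_tridiag6 _ _ _ _ _ uv) /nr_cubic /cubic.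
rewrite !(comp_polyB, comp_polyD, comp_polyZ, comp_polyC, comp_Xn_poly).
rewrite comp_polyX /w -!(polyCD, polyCM, rmorphD, rmorphM) /=.
rewrite !(rmorphB, rmorphD) /= !(map_polyZ, map_polyC, rmorphXn) /= map_polyX.
by rewrite -!mul_polyC; ring.
Qed.

(** Both polynomials have real coefficients. *)
Lemma ellipse_dvd_NRpoly (R : realType) (A : 'M[R[i]]_6) (w0 : R[i])
    (x y z theta : R) :
    reciprocal A ->
  (ellipse_poly w0 x y z theta %| NRpoly A theta) =
  (('X - (complex.Re (cis theta * w0))%:P) ^+ 2
     - (x * cos (2 * theta) + y * sin (2 * theta) + z)%:P
   %| nr_cubic (mean_sqr A) (cos (2 * theta)) \Po 'X^2).
Proof.
move=> hA; rewrite NRpoly_nr_cubic // -(dvdp_map (real_complex R)).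
by congr (_ %| _); rewrite rmorphB rmorphXn rmorphB /= map_polyX !map_polyC.
Qed.

(** * From an ellipse to a line of roots *)

(** The exceptional angles are kept as the zeros of a nonzero affine
    function of tau.  For w0 = w1 + i w2 <> 0 they are the zeros of
    l(theta) l(- theta), where l(theta) = Re(e^(i theta) w0), up to a factor 2:
    taking this symmetric product, rather than l alone, makes the condition
    depend on tau only. *)
Lemma ellipse_harmonic_root (R : realType) (A : 'M[R[i]]_6) :
    reciprocal A -> has_elliptical_component A ->
  exists x y z al be : R, (al, be) != (0, 0) /\
    forall theta, al + be * cos (2 * theta) != 0 ->
      root (nr_cubic (mean_sqr A) (cos (2 * theta)))
           (x * cos (2 * theta) + y * sin (2 * theta) + z).
Proof.
move=> hA [[w1 w2] [x [y [z [_ _ dvdE]]]]]; set a := mean_sqr A.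
have [[w1E w2E] | w_neq0] := eqVneq (w1, w2) (0, 0).
  exists x, y, z, 1, 0.
  split=> [|theta _]; first by rewrite xpair_eqE oner_eq0.
  have := dvdE theta; rewrite ellipse_dvd_NRpoly //= w1E w2E !mulr0 !subr0.
  by rewrite dvdp_comp_sqr.
exists (5 / 2 - (w1 ^+ 2 - w2 ^+ 2) - 2 * x), (2 * w1 * w2 - 2 * y).
exists (coefS a / 2 - (w1 ^+ 2 + w2 ^+ 2) - 2 * z).
exists (w1 ^+ 2 - w2 ^+ 2), (w1 ^+ 2 + w2 ^+ 2); split.
  apply: contraNneq w_neq0 => -[_ /eqP].
  by rewrite paddr_eq0 ?sqr_ge0 // !sqrf_eq0 xpair_eqE.
move=> theta nbad; have := dvdE theta.
have cs := cos2Dsin2 theta.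
have c2E : cos (2 * theta) = cos theta ^+ 2 - sin theta ^+ 2.
  by rewrite mulr_natl cos_mulr2n; lra.
have s2E : sin (2 * theta) = 2 * (cos theta * sin theta).
  by rewrite mulr_natl sin_mulr2n -mulr_natl.
rewrite ellipse_dvd_NRpoly //= => /dvdp_cubic_offcenter.
move: nbad cs; rewrite c2E s2E; move: (cos theta) (sin theta) => c s nbad cs.
set l := c * w1 - s * w2.
have l0 : l + l != 0.
  apply: contraNneq nbad => l0; have {}l0 : l = 0 by lra.
  apply/eqP; transitivity (2 * l * (c * w1 + s * w2)
                           + (1 - (c ^+ 2 + s ^+ 2)) * (w1 ^+ 2 - w2 ^+ 2)).
    rewrite /l; ring.
  by rewrite l0 cs subrr !mulr0 mul0r mul0r addr0.
move=> /(_ l0); congr (root _ _); rewrite /l /coefS /a; apply/eqP.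
rewrite -subr_eq0; apply/eqP.
transitivity ((w1 ^+ 2 + w2 ^+ 2) * (1 - (c ^+ 2 + s ^+ 2))); first by field.
by rewrite cs subrr mulr0.
Qed.

(** Only tau strictly between -1 and 1 is used: there sin (2 theta) does not
    vanish, so that the roots at theta and - theta differ when y <> 0. *)
Lemma harmonic_root_line (R : realType) (a : 'I_5 -> R) (x y z al be : R) :
    (forall theta, al + be * cos (2 * theta) != 0 ->
      root (nr_cubic a (cos (2 * theta)))
           (x * cos (2 * theta) + y * sin (2 * theta) + z)) ->
  exists x' z' : R, forall tau, -1 < tau < 1 -> al + be * tau != 0 ->
    root (nr_cubic a tau) (x' * tau + z').
Proof.
move=> harm.
have harm2 (tau : R) : -1 < tau < 1 -> al + be * tau != 0 ->
    exists2 sg, sg != 0 & root (nr_cubic a tau) (x * tau + y * sg + z)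
                       /\ root (nr_cubic a tau) (x * tau - y * sg + z).
  move=> /andP[tau_gtN1 tau_lt1] nbad.
  have tau_itv : tau \in `[-1, 1] by rewrite in_itv /= !ltW.
  have dbl : 2 * (acos tau / 2) = acos tau by field.
  have := (harm (acos tau / 2), harm (- (acos tau / 2))).
  rewrite mulrN dbl cosN sinN acosK // mulrN => -[h1 h2].
  exists (sin (acos tau)); last by split; [exact: h1 | exact: h2].
  rewrite sin_acos ?(ltW tau_gtN1) ?(ltW tau_lt1) //.
  rewrite gt_eqF // sqrtr_gt0; nra.
have [y0 | y0] := eqVneq y 0.
  exists x, z => tau tau_itv nbad; have [sg _ []] := harm2 tau tau_itv nbad.
  by rewrite y0 mul0r addr0.
exists (5 / 2 - 2 * x), (coefS a / 2 - 2 * z) => tau tau_itv nbad.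
have [sg sg0 [h1 h2]] := harm2 tau tau_itv nbad.
have ne : x * tau + y * sg + z != x * tau - y * sg + z.
  rewrite -subr_eq0; have -> : x * tau + y * sg + z - (x * tau - y * sg + z)
    = y * sg * 2 by ring.
  by rewrite !mulf_neq0 ?pnatr_eq0.
have := root_cubic_third _ _ _ _ _ _ ne h1 h2.
congr (root _ _); rewrite /coefS; by field.
Qed.

(** A polynomial in tau that vanishes on an interval after multiplication by a
    nonzero affine factor is zero. *)
Lemma line_root_extend (R : realType) (a : 'I_5 -> R) (x z al be : R) :
    (al, be) != (0, 0) ->
    (forall tau, -1 < tau < 1 -> al + be * tau != 0 ->
      root (nr_cubic a tau) (x * tau + z)) ->
  forall tau, root (nr_cubic a tau) (x * tau + z).
Proof.
move=> albe line tau.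
pose p : {poly R} :=
  ((8 * x ^+ 3 - 20 * x ^+ 2 + 12 * x - 1) / 8) *: 'X^3
    + ((q11 R).[x] * z + (q10 a).[x]) *: 'X^2
    + ((q22 R).[x] * z ^+ 2 + (q21 a).[x] * z + (q20 a).[x]) *: 'X
    + (z ^+ 3 + (q32 a).[x] * z ^+ 2 + (q31 a).[x] * z + (q30 a).[x])%:P.
have pE t : p.[t] = (nr_cubic a t).[x * t + z].
  rewrite horner_nr_cubic_line.
  by rewrite !(hornerD, hornerZ, hornerXn, hornerX, hornerC).
pose g : {poly R} := al%:P + be *: 'X.
have gE t : g.[t] = al + be * t.
  by rewrite !(hornerD, hornerZ, hornerX, hornerC).
have g0 : g != 0.
  apply: contraNneq albe => /polyP g0; have := (g0 0%N, g0 1%N).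
  by rewrite !coefE /= mulr0 mulr1 addr0 add0r => -[-> ->].
have : g * p = 0.
  apply: poly_eq0_on_itv => t t_itv; rewrite hornerM pE gE.
  have [->|nbad] := eqVneq (al + be * t) 0; first by rewrite mul0r.
  by rewrite (eqP (line t t_itv nbad)) mulr0.
move/eqP; rewrite mulf_eq0 (negPf g0) /= /root -pE => /eqP ->.
by rewrite horner0.
Qed.

(** * Elliptical components *)

Lemma nr_cubic_root_ge0 (F : realFieldType) (a : 'I_5 -> F) (tau t : F) :
    (forall j, 1 <= a j) -> -1 <= tau -> root (nr_cubic a tau) t -> 0 <= t.
Proof.
move=> a_ge1 tau_geN1; have u_ge0 j : 0 <= (a j + tau) / 2.
  by rewrite divr_ge0 //; have := a_ge1 j; lra.
by apply: cubic_root_ge0; rewrite ?(u_ge0, addr_ge0, mulr_ge0).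
Qed.

Theorem theorem9 (R : realType) (A : 'M[R[i]]_6) (hA : reciprocal A) :
  has_elliptical_component A <->
  exists x : R,
    [/\ 8 * x ^+ 3 - 20 * x ^+ 2 + 12 * x - 1 = 0,
        (R1 (mean_sqr A)).[x] = 0 & (R2 (mean_sqr A)).[x] = 0].
Proof.
set a := mean_sqr A.
have R1x x : (R1 a).[x] = (q22 R).[x] * (q10 a).[x] ^+ 2
    - (q21 a).[x] * (q10 a).[x] * (q11 R).[x] + (q20 a).[x] * (q11 R).[x] ^+ 2.
  by rewrite R1E !(hornerD, hornerN, hornerM, horner_exp).
have R2x x : (R2 a).[x] = - (- (q10 a).[x] ^+ 3
    + (q32 a).[x] * (q10 a).[x] ^+ 2 * (q11 R).[x]
    - (q31 a).[x] * (q10 a).[x] * (q11 R).[x] ^+ 2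
    + (q30 a).[x] * (q11 R).[x] ^+ 3).
  by rewrite R2E !(hornerD, hornerN, hornerM, horner_exp).
split=> [hell | [x [fx]]].
  have [x [y [z [al [be [albe harm]]]]]] :=
    ellipse_harmonic_root _ _ hA hell.
  have [x' [z' line]] := harmonic_root_line _ _ _ _ _ _ _ harm.
  have /nr_cubic_line_root[fx c2 c1 c0] :=
    line_root_extend _ _ _ _ _ _ albe line.
  have q10E : (q10 a).[x'] = - ((q11 R).[x'] * z').
    by apply/eqP; rewrite -addr_eq0 addrC c2.
  exists x'; split=> //; rewrite ?R1x ?R2x q10E.
    rewrite -(mulr0 ((q11 R).[x'] ^+ 2)) -c1; ring.
  rewrite -(mulr0 (- (q11 R).[x'] ^+ 3)) -c0; ring.
have q11x := q11_root_neq0 _ _ fx; rewrite R1x R2x => r1 r2.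
pose z := - (q10 a).[x] / (q11 R).[x].
have q10E : (q10 a).[x] = - ((q11 R).[x] * z) by rewrite /z; field.
(* With q10 = - q11 z, R1 = q11^2 Q2(z) and R2 = - q11^3 Q3(z). *)
have line : forall tau, root (nr_cubic a tau) (x * tau + z).
  apply/nr_cubic_line_root; split=> //; first by rewrite q10E subrr.
    apply: (mulfI (expf_neq0 2 q11x)); rewrite mulr0 -r1 q10E; ring.
  apply: (mulfI (expf_neq0 3 q11x)); rewrite mulr0 -[RHS]oppr0 -r2 q10E; ring.
have a_ge1 j : 1 <= a j by exact: mean_sqr_ge1.
have x0 : x != 0.
  apply: contra_eq_neq fx => ->.
  by rewrite !expr0n /= !mulr0 subrr addr0 sub0r oppr_eq0 oner_eq0.
have zx : `|x| <= z.
  have ge0 tau : -1 <= tau -> 0 <= x * tau + z.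
    by move=> tau_ge; apply: nr_cubic_root_ge0 a_ge1 tau_ge (line tau).
  have := ge0 (-1) (lexx _); have := ge0 1 ltac:(lra).
  by rewrite ler_norml; lra.
exists 0, x, 0, z; split.
- by rewrite expr0n addr0 sqrtr_sqr.
- by rewrite (lt_le_trans _ zx) ?normr_gt0.
move=> theta; rewrite ellipse_dvd_NRpoly // mulr0 /= subr0.
by rewrite mul0r addr0 dvdp_comp_sqr.
Qed.
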